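(* Let $G$ be a group and $(X,\pi)$ a uniformly convex isometric Banach $G$-module. Assume that $F$ is a subgroup of $G$ such that $X$ has no almost invariant unit vectors as an $\mathsf{FC}_G(F)$-module. Then the restriction map $$H^n(G,X)\to H^n(F,X)$$ is zero for all $n\geqslant 0$.
   Context: All Banach spaces are real and groups are discrete. A Banach $G$-module is a pair $(X,\pi)$ with $X$ a Banach space and $\pi$ an action of $G$ on $X$ by bounded linear automorphisms; it is isometric if each $\pi(g)$ is an isometry, and uniformly convex if $X$ is: for every $\epsilon>0$ there is $\delta>0$ with $\|\frac{x+y}2\|\leqslant 1-\delta$ whenever $\|x\|=\|y\|=1$ and $\|x-y\|\geqslant\epsilon$. For a subgroup $F\leqslant G$, $\mathsf{FC}_G(F)=\{g\in G: \{fgf^{-1}: f\in F\}\text{ is finite}\}$; this is a subgroup of $G$. For a group $H$, an isometric Banach $H$-module $(X,\pi)$ has almost invariant unit vectors if for all finite $E\subseteq H$ and $\epsilon>0$ there is a unit vector $x\in X$ with $\|x-\pi(h)x\|<\epsilon$ for all $h\in E$. For $H\leqslant G$, $X$ is an $H$-module by restricting $\pi$. $C^n(G,X)$ is the vector space of all maps $G^n\to X$ (with $C^0(G,X)=X$). The coboundary operator $\partial^{n+1}:C^n(G,X)\to C^{n+1}(G,X)$ is $$(\partial^{n+1}\phi)(g_1,\ldots,g_{n+1})=-\pi(g_1)\phi(g_2,\ldots,g_{n+1})+(-1)^n\phi(g_1,\ldots,g_n)-\sum_{i=1}^n(-1)^i\phi(g_1,\ldots,g_{i-1},g_ig_{i+1},g_{i+2},\ldots,g_{n+1}),$$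 and $\partial^0:\{0\}\to C^0(G,X)$ is the zero map. $Z^n(G,X)=\ker\partial^{n+1}$, $B^n(G,X)=\operatorname{range}\partial^n$ and $H^n(G,X)=Z^n(G,X)/B^n(G,X)$. The restriction map is induced by $\phi\mapsto\phi|_{F^n}$. *)

(* Defs.v *)
From HB Require Import structures.
From mathcomp Require Import all_boot all_order all_algebra.
From mathcomp Require Import all_classical all_reals all_analysis.

Set Implicit Arguments.
Unset Strict Implicit.
Unset Printing Implicit Defensive.

Import Order.TTheory GRing.Theory Num.Theory.
Import numFieldNormedType.Exports.
Import Quotient.
Local Open Scope classical_set_scope.
Local Open Scope ring_scope.
Local Open Scope quotient_scope.

(* Groups are arbitrary, not necessarily finite: a subgroup of                *)
(* [G : groupType] is a predicate [H : groupClosed G], and [subgroup_of H] is *)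
(* the group that it carries.                                                 *)
Record subgroup_of (G : groupType) (H : groupClosed G) : Type :=
  SubgroupOf { sgval : G; sgvalP : sgval \in H }.

HB.instance Definition _ (G : groupType) (H : groupClosed G) :=
  [isSub for @sgval G H].
HB.instance Definition _ (G : groupType) (H : groupClosed G) :=
  [Choice of subgroup_of H by <:].

Lemma groupClosed_group_closed (G : groupType) (H : groupClosed G) :
  group_closed H.
Proof.
by split=> [|x y Hx Hy]; [exact: gpred1 | apply: gpredM; rewrite ?gpredV].
Qed.

HB.instance Definition _ (G : groupType) (H : groupClosed G) :=
  SubChoice_isSubGroup.Build G (mem H) (subgroup_of H)
    (groupClosed_group_closed H).

Lemma sgvalM (G : groupType) (H : groupClosed G) :
  {morph @sgval G H : x y / (x * y)%g}.
Proof. by move=> x y; exact: valM. Qed.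

Lemma sgval1 (G : groupType) (H : groupClosed G) : @sgval G H 1%g = 1%g.
Proof. exact: val1. Qed.

Section FC.
Variables (G : groupType) (F : groupClosed G).

Definition FC : {pred G} :=
  fun g => `[< finite_set [set (f * g * f^-1)%g | f in [set` F]] >].

Lemma FC_group_closed : group_closed FC.
Proof.
split=> [|x y].
  apply/asboolP; apply: (sub_finite_set _ (finite_set1 (1%g : G))).
  by move=> _ [f _ <-] /=; rewrite mulg1 mulgV.
move=> /asboolP Fx /asboolP Fy; apply/asboolP.
apply: (sub_finite_set _ (finite_image2 (fun a b => (a / b)%g) Fx Fy)).
move=> _ [f Ff <-]; exists (f * x * f^-1)%g; first by exists f.
exists (f * y * f^-1)%g; first by exists f.
by rewrite !invgM invgK !mulgA mulgVK.
Qed.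

HB.instance Definition _ := isMulClosed.Build G FC
  (group_closedM FC_group_closed).
HB.instance Definition _ := isMul1Closed.Build G FC (fst FC_group_closed).
HB.instance Definition _ := isInvClosed.Build G FC
  (group_closedV FC_group_closed).

End FC.

Definition uniformly_convex (R : realType) (X : completeNormedModType R) :=
  forall eps : R, 0 < eps -> exists2 delta : R, 0 < delta &
    forall x y : X, `|x| = 1 -> `|y| = 1 -> eps <= `|x - y| ->
      `|2^-1 *: (x + y)| <= 1 - delta.

(* Invertibility of each [rho g], with bounded inverse [rho g^-1], follows    *)
(* from the action axioms.                                                    *)
Record banach_module (R : realType) (G : groupType)
    (X : completeNormedModType R) : Type := BanachModule {
  module_act :> G -> X -> X;
  module_linear : forall g, linear (module_act g);
  module_bounded : forall g, exists M : R, forall x,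
    `|module_act g x| <= M * `|x|;
  module_act1 : forall x, module_act 1%g x = x;
  module_actM : forall g h x,
    module_act (g * h)%g x = module_act g (module_act h x)
}.

Section Modules.
Variables (R : realType) (G : groupType) (X : completeNormedModType R).
Variable rho : banach_module G X.

Definition isometric := forall g x, `|rho g x| = `|x|.

Definition almost_invariant_unit_vectors :=
  forall (E : set G) (eps : R), finite_set E -> 0 < eps ->
    exists2 x : X, `|x| = 1 & forall h, E h -> `|x - rho h x| < eps.

Program Definition restrict_module (H : groupClosed G) :
    banach_module (subgroup_of H) X :=
  @BanachModule R (subgroup_of H) X (fun h => rho (sgval h)) _ _ _ _.
Next Obligation. by move=> H h; exact: module_linear. Qed.
Next Obligation. by move=> H h; exact: module_bounded. Qed.
Next Obligation. by move=> H x /=; rewrite module_act1. Qed.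
Next Obligation. by move=> H g h x /=; rewrite module_actM. Qed.

End Modules.

Section Cohomology.
Variables (R : realType) (G : groupType) (X : completeNormedModType R).
Variable rho : banach_module G X.

HB.instance Definition _ g :=
  GRing.isLinear.Build R X X *:%R (rho g) (module_linear rho g).

Definition cochain (n : nat) : Type := ('I_n -> G) -> X.
HB.instance Definition _ n := GRing.Lmodule.on (cochain n).

(* An [n]-tuple [(g_1, ..., g_n)] is a function [g : 'I_n -> G], with         *)
(* [g_(i+1)] the value of [g] at the ordinal [i]. [merge g i] is              *)
(* [(g_1, ..., g_i, g_(i+1) g_(i+2), g_(i+3), ..., g_(n+1))].                 *)
Definition merge n (g : 'I_n.+1 -> G) (i : 'I_n) : 'I_n -> G := fun j =>
  if (j < i)%N then g (lift ord_max j)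
  else if j == i then (g (lift ord_max i) * g (lift ord0 i))%g
  else g (lift ord0 j).

Definition coboundary n (phi : cochain n) : cochain n.+1 := fun g =>
  - rho (g ord0) (phi (fun j => g (lift ord0 j)))
  + (-1) ^+ n *: phi (fun j => g (lift ord_max j))
  - \sum_(i < n) (-1) ^+ i.+1 *: phi (merge g i).

Lemma coboundary_is_linear n : linear (@coboundary n).
Proof.
move=> a phi psi; apply/funext => g.
have evE m (u v : cochain m) h : (a *: u + v) h = a *: u h + v h by [].
rewrite evE /coboundary !evE linearP.
under eq_bigr do rewrite evE scalerDr scalerA mulrC -scalerA.
rewrite big_split /= -scaler_sumr !scalerDr !scalerN !scalerA (mulrC a) !opprD.
rewrite -!addrA; congr (_ + _).
set x1 := _ *: phi _; set x2 := - rho _ _; set x3 := _ *: psi _.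
set x4 := - (a *: _); set x5 := - \sum_(i < n) _.
rewrite addrCA; congr (_ + _).
by rewrite [RHS]addrCA; congr (_ + _); rewrite addrCA.
Qed.

HB.instance Definition _ n := GRing.isLinear.Build R (cochain n)
  (cochain n.+1) *:%R (@coboundary n) (@coboundary_is_linear n).

Definition is_cocycle n : {pred cochain n} := fun phi => coboundary phi == 0.

Lemma is_cocycle_submod_closed n : subsemimod_closed (@is_cocycle n).
Proof.
apply: GRing.submod_closed_semi; split=> [|a phi psi].
  by rewrite unfold_in /is_cocycle raddf0.
rewrite !unfold_in /is_cocycle => /eqP phi0 /eqP psi0.
by rewrite linearP /= phi0 psi0 scaler0 addr0.
Qed.

HB.instance Definition _ n := GRing.isSubmodClosed.Build R (cochain n)
  (@is_cocycle n) (@is_cocycle_submod_closed n).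

Record cocycle n : Type :=
  Cocycle { cocycle_val : cochain n; cocycleP : cocycle_val \in @is_cocycle n }.

HB.instance Definition _ n := [isSub for @cocycle_val n].
HB.instance Definition _ n := [Choice of cocycle n by <:].
HB.instance Definition _ n := [SubChoice_isSubLmodule of cocycle n by <:].

(* The range of the coboundary operator with target [cochain n]; for [n = 0]  *)
(* that operator is the zero map on the zero space.                           *)
Definition coboundary_range n : set (cochain n) :=
  match n with
  | 0 => [set 0]
  | m.+1 => range (@coboundary m)
  end.

Definition is_coboundary n : {pred cocycle n} :=
  fun z => `[< coboundary_range (val z) >].

Lemma is_coboundary_submod_closed n : subsemimod_closed (@is_coboundary n).
Proof.
apply: GRing.submod_closed_semi; case: n => [|n]; split=> [|c x y].
- by apply/asboolP; exact: (raddf0 val).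
- move=> /asboolP xE /asboolP yE; apply/asboolP; rewrite linearP.
  by move: xE yE => /= -> ->; rewrite scaler0 addr0.
- by apply/asboolP; exists 0 => //; rewrite !raddf0.
- move=> /asboolP [a _ xE] /asboolP [b _ yE]; apply/asboolP.
  by exists (c *: a + b) => //; rewrite [RHS]linearP linearP /= xE yE.
Qed.

HB.instance Definition _ n := GRing.isSubmodClosed.Build R (cocycle n)
  (@is_coboundary n) (@is_coboundary_submod_closed n).

Definition cohomology n : Type := {quot @is_coboundary n}.
HB.instance Definition _ n := GRing.Zmodule.on (cohomology n).

Definition cohomology_class n (z : cocycle n) : cohomology n :=
  \pi_{quot @is_coboundary n} z.

Lemma cohomology_classP n (z w : cocycle n) :
  cohomology_class z = cohomology_class w <-> coboundary_range (val (z - w)).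
Proof.
split=> [/eqmodP|zw]; first by move=> /asboolP.
by apply/eqmodP/asboolP.
Qed.

Lemma cohomology_class_is_zmod_morphism n : zmod_morphism (@cohomology_class n).
Proof. exact: raddfB. Qed.

HB.instance Definition _ n := GRing.isZmodMorphism.Build (cocycle n)
  (cohomology n) (@cohomology_class n) (@cohomology_class_is_zmod_morphism n).

Lemma cohomology_class_repr n (c : cohomology n) :
  cohomology_class (repr (c : {quot @is_coboundary n})) = c.
Proof. exact: reprK. Qed.

Definition cohomology_scale n (a : R) (c : cohomology n) : cohomology n :=
  cohomology_class (a *: repr (c : {quot @is_coboundary n})).

Lemma cohomology_scale_class n (a : R) (z : cocycle n) :
  cohomology_scale a (cohomology_class z) = cohomology_class (a *: z).
Proof.
apply/cohomology_classP/asboolP; rewrite -/(is_coboundary _) -scalerBr.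
apply: (@rpredZ R _ (@is_coboundary n)); apply/asboolP/cohomology_classP.
exact: cohomology_class_repr.
Qed.

Lemma cohomology_scaleA n a b (c : cohomology n) :
  cohomology_scale a (cohomology_scale b c) = cohomology_scale (a * b) c.
Proof.
by rewrite -(cohomology_class_repr c) !cohomology_scale_class scalerA.
Qed.

Lemma cohomology_scale1 n : left_id 1 (@cohomology_scale n).
Proof.
by move=> c; rewrite -(cohomology_class_repr c) cohomology_scale_class scale1r.
Qed.

Lemma cohomology_scaleDr n : right_distributive (@cohomology_scale n) +%R.
Proof.
move=> a c d; rewrite -(cohomology_class_repr c) -(cohomology_class_repr d).
by rewrite -raddfD !cohomology_scale_class scalerDr raddfD.
Qed.

Lemma cohomology_scaleDl n (c : cohomology n) :
  {morph (@cohomology_scale n)^~ c : a b / a + b}.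
Proof.
move=> a b; rewrite -(cohomology_class_repr c) !cohomology_scale_class.
by rewrite scalerDl raddfD.
Qed.

HB.instance Definition _ n := GRing.Zmodule_isLmodule.Build R (cohomology n)
  (@cohomology_scaleA n) (@cohomology_scale1 n) (@cohomology_scaleDr n)
  (@cohomology_scaleDl n).

Lemma cohomology_class_is_scalable n : scalable (@cohomology_class n).
Proof. by move=> a z; rewrite -cohomology_scale_class. Qed.

HB.instance Definition _ n := GRing.isScalable.Build R (cocycle n)
  (cohomology n) *:%R (@cohomology_class n) (@cohomology_class_is_scalable n).

End Cohomology.

Section Restriction.
Variables (R : realType) (G : groupType) (X : completeNormedModType R).
Variables (rho : banach_module G X) (F : groupClosed G).
Local Notation rhoF := (restrict_module rho F).

Definition res_cochain n (phi : cochain G X n) : cochain (subgroup_of F) X n :=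
  fun f => phi (fun i => sgval (f i)).

Lemma coboundary_res n (phi : cochain G X n) :
  coboundary rhoF (res_cochain phi) = res_cochain (coboundary rho phi).
Proof.
apply/funext => f; rewrite /coboundary /res_cochain /=; congr (_ - _).
apply: eq_bigr => i _; congr (_ *: phi _); apply/funext => j.
by rewrite /merge; case: ifP => // _; case: ifP => // _; rewrite sgvalM.
Qed.

Lemma res_cocycleP n (z : cocycle rho n) :
  res_cochain (cocycle_val z) \in @is_cocycle R _ X rhoF n.
Proof.
apply/eqP; rewrite coboundary_res.
by have /eqP -> := cocycleP z; apply/funext.
Qed.

Definition res_cocycle n (z : cocycle rho n) : cocycle rhoF n :=
  Cocycle (res_cocycleP z).

Definition res_cohomology n (c : cohomology rho n) : cohomology rhoF n :=
  cohomology_class (res_cocycle (repr (c : {quot @is_coboundary R G X rho n}))).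

Lemma res_cocycleB n (z w : cocycle rho n) :
  val (res_cocycle z - res_cocycle w) = res_cochain (val (z - w)).
Proof. by []. Qed.

Lemma res_cohomology_class n (z : cocycle rho n) :
  res_cohomology (cohomology_class z) = cohomology_class (res_cocycle z).
Proof.
have /cohomology_classP := cohomology_class_repr (cohomology_class z).
rewrite /res_cohomology; set w := repr _ => wz; apply/cohomology_classP.
rewrite res_cocycleB; move: (val _) wz => {w z}.
case: n => [|n] phi; first by move=> ->.
by case=> psi _ <-; exists (res_cochain psi) => //; rewrite coboundary_res.
Qed.

Lemma res_cohomology_is_linear n : linear (@res_cohomology n).
Proof.
move=> a c d; rewrite -(cohomology_class_repr c) -(cohomology_class_repr d).
move: (repr _) (repr _) => z w.
rewrite -linearP !res_cohomology_class -linearP.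
by congr cohomology_class; exact/val_inj.
Qed.

HB.instance Definition _ n := GRing.isLinear.Build R (cohomology rho n)
  (cohomology rhoF n) *:%R (@res_cohomology n) (@res_cohomology_is_linear n).

End Restriction.

(* Main.v *)
Require Import Defs.
From HB Require Import structures.
From mathcomp Require Import all_boot all_order all_algebra.
From mathcomp Require Import all_classical all_reals all_analysis.
From mathcomp Require Import lra.

Import Order.TTheory GRing.Theory Num.Theory.
Import numFieldNormedType.Exports.
Local Open Scope ring_scope.
(* [merge] alone would denote the merging of sorted sequences. *)
Local Notation merge := Defs.merge.

(** Since [X] has no almost invariant unit vectors over [FC F], there are a
finite set [s] of elements of [G] and [eps > 0] such that every unit vector is
moved by at least [eps] by some element of [s]. The elements of [FC F] have
finite [F]-orbits under conjugation, so [s] may be taken to contain [1] and to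
be stable under conjugation by [F] (lemma [finite_FC_conj_closed]). Let [T] be
the mean of the operators [rho h] for [h] in [s].

On the one hand, uniform convexity gives [T] norm less than [1]: among the
summands, [x] and some [rho h x] are [eps]-apart, so their midpoint is uniformly
inside the unit ball. Hence the operator [A = \sum_(h <- s) (rho h - 1)], which is
[#s * (T - 1)], is bijective (lemma [deviation_bij]). It commutes with [F]
because [s] is stable under conjugation, so both [A] and its inverse commute
with the coboundary operators over [F].

On the other hand, [A] maps the restriction to [F] of a cocycle over [G] to a
coboundary (lemma [bicocycle_sub_range]); this is a form of the triviality of
conjugation on cohomology. For instance, if [b] is a 1-cocycle, then equating
[b (h f)] and [b (f (f^-1 h f))] and summing over [h] shows that [A (b f)] is
[rho f v - v] with [v = \sum_(h <- s) b h]. If now [phi] is a cocycle with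
[A phi = d psi] on [F], then [phi = d (A^-1 psi)] on [F].

The statement on cocycles is proved by dimension shifting. An [n.+1]-cochain
with values in [M] is the same as an [n]-cochain with values in [G -> M], the
last variable being the argument of the function, but then the action on the
right becomes nontrivial. So the induction is on two-sided coefficients: for
operators [l] and [r] of [G] on [M] and a cocycle [phi], the cochain
[\sum_(h <- s) (l h phi - r h phi)] is a coboundary on [F]. Neither the axioms of
an action nor the compatibility of [l] and [r] play a role, only linearity. *)

(** * Appending an element to a tuple *)

Section Tuples.
Context {G : groupType}.

(** [snoc g x] is the tuple [(g_1, ..., g_n, x)]. *)
Definition snoc {n} (g : 'I_n -> G) (x : G) : 'I_n.+1 -> G :=
  fun j => oapp g x (unlift ord_max j).

Lemma lift0_lift_max n (k : 'I_n) :
  lift ord0 (lift ord_max k) = lift ord_max (lift ord0 k) :> 'I_n.+2.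
Proof.
by apply: ord_inj; rewrite lift0 !lift_max lift0.
Qed.

Lemma lift0_max n : lift ord0 (@ord_max n) = ord_max.
Proof. exact/val_inj. Qed.

Lemma snoc_lift n (g : 'I_n -> G) x j : snoc g x (lift ord_max j) = g j.
Proof. by rewrite /snoc liftK. Qed.

Lemma snoc_max n (g : 'I_n -> G) x : snoc g x ord_max = x.
Proof. by rewrite /snoc unlift_none. Qed.

Lemma snoc_belast n (g : 'I_n -> G) x :
  (fun j => snoc g x (lift ord_max j)) = g.
Proof. by apply/funext => j; rewrite snoc_lift. Qed.

Lemma snoc_eta n (g : 'I_n.+1 -> G) :
  snoc (fun j => g (lift ord_max j)) (g ord_max) = g.
Proof.
by apply/funext => j; rewrite /snoc; case: unliftP => [k|] ->.
Qed.

Lemma snoc_behead n (g : 'I_n.+1 -> G) x :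
  (fun j => snoc g x (lift ord0 j)) = snoc (fun j => g (lift ord0 j)) x.
Proof.
apply/funext => j; case: (unliftP ord_max j) => [k|] ->.
  by rewrite lift0_lift_max !snoc_lift.
by rewrite lift0_max !snoc_max.
Qed.

Lemma merge_snoc_lift n (g : 'I_n.+1 -> G) x (i : 'I_n) :
  merge (snoc g x) (lift ord_max i) = snoc (merge g i) x.
Proof.
apply/funext => j; case: (unliftP ord_max j) => [k|] ->.
  rewrite snoc_lift /merge lift0_lift_max !snoc_lift !lift_max (inj_eq lift_inj).
  by case: ifP => // _; case: ifP => // _; rewrite lift0_lift_max snoc_lift.
rewrite snoc_max /merge lift_max /= ltnNge (ltnW (ltn_ord i)) /=.
rewrite -(inj_eq (@ord_inj _)) lift_max gtn_eqF ?ltn_ord //=.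
by rewrite lift0_max snoc_max.
Qed.

Lemma merge_snoc_max n (g : 'I_n.+1 -> G) x :
  merge (snoc g x) ord_max =
  snoc (fun j => g (lift ord_max j)) (g ord_max * x)%g.
Proof.
apply/funext => j; case: (unliftP ord_max j) => [k|] ->.
  by rewrite /merge lift_max ltn_ord !snoc_lift.
rewrite /merge ltnn eqxx !snoc_lift.
by rewrite lift0_max !snoc_max.
Qed.

End Tuples.

(** * Cochains with two-sided coefficients *)

Section TwoSided.
Context {R : realType} {G : groupType}.

(** The Hochschild-type coboundary operator with [G] acting on the coefficients
[M] by [l] on the left and by [r] on the right; [l] and [r] are arbitrary
families of linear maps. The ordinary coboundary is the case where [r g] is
the identity. *)
Definition bicoboundary {M : lmodType R} (l r : G -> {linear M -> M}) {n}
    (phi : ('I_n -> G) -> M) (g : 'I_n.+1 -> G) : M :=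
  - l (g ord0) (phi (fun j => g (lift ord0 j)))
  + (-1) ^+ n *: r (g ord_max) (phi (fun j => g (lift ord_max j)))
  - \sum_(i < n) (-1) ^+ i.+1 *: phi (merge g i).

Lemma bicoboundary_linear (M : lmodType R) (l r : G -> {linear M -> M}) n :
  linear (@bicoboundary M l r n).
Proof.
move=> a phi psi; apply/funext => g.
have evE m (u v : ('I_m -> G) -> M) h : (a *: u + v) h = a *: u h + v h by [].
rewrite evE /bicoboundary !evE !linearP.
under eq_bigr do rewrite evE scalerDr scalerA mulrC -scalerA.
rewrite big_split /= -scaler_sumr !scalerDr !scalerN !scalerA (mulrC a) !opprD.
by rewrite [RHS]addrACA; congr (_ + _); rewrite addrACA.
Qed.

HB.instance Definition _ (M : lmodType R) (l r : G -> {linear M -> M}) n :=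
  GRing.isLinear.Build R (('I_n -> G) -> M) (('I_n.+1 -> G) -> M) *:%R
    (@bicoboundary M l r n) (@bicoboundary_linear M l r n).

Section Shift.
Context {M : lmodType R}.

(** The operators on [G -> M] for which currying the last variable of cochains
commutes with coboundaries. *)
Definition lshift_act (l : G -> {linear M -> M}) g (m : G -> M) : G -> M :=
  fun x => l g (m x).

Definition rshift_act (r : G -> {linear M -> M}) g (m : G -> M) : G -> M :=
  fun x => m (g * x)%g - r x (m g).

Lemma lshift_act_linear l g : linear (lshift_act l g).
Proof.
move=> a m m'; apply/funext => x; rewrite /lshift_act.
by rewrite [LHS]linearP.
Qed.

Lemma rshift_act_linear r g : linear (rshift_act r g).
Proof.
move=> a m m'; apply/funext => x; rewrite /rshift_act.
rewrite -[RHS]/(a *: (m (g * x)%g - r x (m g)) + (m' (g * x)%g - r x (m' g))).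
rewrite -[(a *: m + m') g]/(a *: m g + m' g) linearP.
rewrite -[(a *: m + m') _]/(a *: m (g * x)%g + m' (g * x)%g).
by rewrite scalerBr opprD addrACA.
Qed.

HB.instance Definition _ l g :=
  GRing.isLinear.Build R (G -> M) (G -> M) *:%R (lshift_act l g)
    (lshift_act_linear l g).
HB.instance Definition _ r g :=
  GRing.isLinear.Build R (G -> M) (G -> M) *:%R (rshift_act r g)
    (rshift_act_linear r g).

Definition lshift_lin l g : {linear (G -> M) -> (G -> M)} := lshift_act l g.
Definition rshift_lin r g : {linear (G -> M) -> (G -> M)} := rshift_act r g.

Lemma bicoboundary_shiftE l r n (Phi : ('I_n -> G) -> G -> M) g x :
  bicoboundary (lshift_lin l) (rshift_lin r) Phi g x =
  - l (g ord0) (Phi (fun j => g (lift ord0 j)) x)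
  + (-1) ^+ n *: (Phi (fun j => g (lift ord_max j)) (g ord_max * x)%g
      - r x (Phi (fun j => g (lift ord_max j)) (g ord_max)))
  - \sum_(i < n) (-1) ^+ i.+1 *: Phi (merge g i) x.
Proof.
rewrite /bicoboundary; set S := \sum_(i < n) _.
rewrite -[LHS]/(_ - S x); congr (_ - _).
by rewrite /S fct_sumE.
Qed.

(** Dimension shifting: currying the last variable turns the coboundary for
[l] and [r] into the coboundary for the shifted operators. The last two faces of
the former are the two terms of [rshift_act]. *)
Lemma bicoboundary_snoc l r n (phi : ('I_n.+1 -> G) -> M) g x :
  bicoboundary l r phi (snoc g x) =
  bicoboundary (lshift_lin l) (rshift_lin r) (fun g' y => phi (snoc g' y)) g x.
Proof.
rewrite [LHS]/bicoboundary snoc_behead snoc_belast snoc_max.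
have -> : snoc g x ord0 = g ord0.
  have -> : (@ord0 n.+1) = lift ord_max ord0 by exact/val_inj.
  by rewrite snoc_lift.
rewrite big_ord_recr /= merge_snoc_max.
under eq_bigr => i _.
  have -> : widen_ord (leqnSn n) i = lift ord_max i.
    by apply: ord_inj; rewrite lift_max.
  rewrite merge_snoc_lift; over.
rewrite bicoboundary_shiftE snoc_eta -!addrA; congr (_ + _).
by rewrite !exprS !mulN1r !scaleNr scalerBr opprD opprK addrA addrC addrA.
Qed.

(** Evaluation of the coefficients [G -> M] at [h] commutes with the left
operators; the correction term measures its failure to commute with the right
ones. *)
Lemma bicoboundary_eval l r n (phi : ('I_n.+1 -> G) -> M) g h :
  bicoboundary l r (fun g' => phi (snoc g' h)) g =
  bicoboundary (lshift_lin l) (rshift_lin r) (fun g' y => phi (snoc g' y)) g h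
  + (-1) ^+ n *: (r (g ord_max) (phi (snoc (fun j => g (lift ord_max j)) h))
     - phi (snoc (fun j => g (lift ord_max j)) (g ord_max * h)%g)
     + r h (phi g)).
Proof.
rewrite bicoboundary_shiftE [LHS]/bicoboundary.
rewrite snoc_eta [RHS]addrAC -[X in _ = X - _]addrA.
have uvw (u v w : M) : u - v + (w - u + v) = w.
  by rewrite -(addrA w) (addrC (- u)) -(opprB u v) addrCA subrr addr0.
by congr (_ + _ - _); rewrite -scalerDr uvw.
Qed.

End Shift.

(** The coboundaries among [n]-cochains; only [0] in degree [0]. *)
Definition bicoboundary_range {M : lmodType R} (l r : G -> {linear M -> M}) {n} :
    (('I_n -> G) -> M) -> Prop :=
  match n with
  | 0 => fun b => b = 0
  | m.+1 => fun b => exists psi : ('I_m -> G) -> M, b = bicoboundary l r psi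
  end.

Lemma bicoboundary_range_uncurry {M : lmodType R} (l r : G -> {linear M -> M}) n
    (b : ('I_n -> G) -> G -> M) :
  bicoboundary_range (lshift_lin l) (rshift_lin r) b ->
  exists psi : ('I_n -> G) -> M,
    forall g x, b g x = bicoboundary l r psi (snoc g x).
Proof.
case: n b => [b ->|n b [psi ->]]; first by exists 0 => g x; rewrite linear0.
pose p (g : 'I_n.+1 -> G) := psi (fun j => g (lift ord_max j)) (g ord_max).
exists p => g x; rewrite bicoboundary_snoc; congr (bicoboundary _ _ _ g x).
by apply/funext => g'; apply/funext => y; rewrite /p snoc_max snoc_belast.
Qed.

(** If [s] is stable under conjugation by [x], then [h] can be exchanged with
[x * h * x^-1] in a sum over [s]. *)
Lemma big_conj_invariant {M : zmodType} (s : seq G) (x : G) (k : G -> M) :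
  uniq s -> (forall h, (x * h * x^-1 \in s)%g = (h \in s)) ->
  \sum_(h <- s) k (x * h)%g = \sum_(h <- s) k (h * x)%g.
Proof.
move=> us sx; have ps : perm_eq s [seq (x * h * x^-1)%g | h <- s].
  apply: uniq_perm => //.
    by rewrite map_inj_uniq // => a b /mulIg /mulgI.
  move=> h; apply/idP/mapP => [hs|[h' h's ->]]; last by rewrite sx.
  exists (x^-1 * h * x)%g; last by rewrite !mulgA mulgK mulgV mul1g.
  by rewrite -sx !mulgA mulgK mulgV mul1g.
rewrite [RHS](perm_big _ ps) big_map; apply: eq_bigr => h _.
by rewrite mulgVK.
Qed.

(** Restricted to [F], the left and the right operators of a cocycle, summed over
a finite set stable under conjugation by [F], agree up to a coboundary. *)
Lemma bicocycle_sub_range (F : {pred G}) (s : seq G) :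
  uniq s ->
  (forall x h, x \in F -> (x * h * x^-1 \in s)%g = (h \in s)) ->
  forall n (M : lmodType R) (l r : G -> {linear M -> M})
    (phi : ('I_n -> G) -> M), bicoboundary l r phi = 0 ->
  exists2 b, bicoboundary_range l r b & forall g, (forall i, g i \in F) ->
    \sum_(h <- s) (l h (phi g) - r h (phi g)) = b g.
Proof.
move=> us sF; elim=> [|n IH] M l r phi phi0.
  (* In degree 0 the cocycle condition at [h] is the vanishing of the term of
     index [h]. *)
  exists 0 => // g _; apply: big1 => h _.
  have := congr1 (fun f => f (fun=> h)) phi0.
  rewrite /bicoboundary big_ord0 subr0 expr0 scale1r /=.
  rewrite (_ : (fun j : 'I_0 => h) = g); last by apply/funext => -[].
  by rewrite addrC => /(congr1 -%R); rewrite opprB oppr0.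
pose Phi (g : 'I_n -> G) (x : G) := phi (snoc g x).
have Phi0 : bicoboundary (lshift_lin l) (rshift_lin r) Phi = 0.
  by apply/funext => g; apply/funext => x; rewrite -bicoboundary_snoc phi0.
have [b /bicoboundary_range_uncurry [psi bE] bP] := IH _ _ _ _ Phi0.
(* Uncurrying the induction hypothesis leaves, up to the exchange of [h * x] and
   [x * h], the correction of [bicoboundary_eval], summed over [s]: it is up to
   sign the coboundary of [sphi], as [Phi] is a cocycle. *)
pose sphi : ('I_n -> G) -> M := \sum_(h <- s) (fun g => phi (snoc g h)).
exists (bicoboundary l r (psi - (-1) ^+ n *: sphi)); first by eexists.
move=> g Fg; have Fg' i : g (lift ord_max i) \in F by [].
have := congr1 (fun f => f (g ord_max)) (bP _ Fg').
rewrite bE snoc_eta fct_sumE linearB linearZ /= => bg.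
rewrite -[RHS]/(_ g - (-1) ^+ n *: _ g) -bg.
rewrite linear_sum fct_sumE /=.
under [X in _ - _ *: X]eq_bigr do rewrite bicoboundary_eval Phi0 add0r.
rewrite -scaler_sumr scalerA -expr2 sqrr_sign scale1r.
set g' := fun j => g (lift ord_max j); set x := g ord_max.
have -> : \sum_(h <- s)
      (r x (phi (snoc g' h)) - phi (snoc g' (x * h)%g) + r h (phi g)) =
    \sum_(h <- s)
      (r x (phi (snoc g' h)) - phi (snoc g' (h * x)%g) + r h (phi g)).
  rewrite !big_split /= !sumrN.
  have sx h : ((x * h * x^-1)%g \in s) = (h \in s) by apply: sF; exact: Fg.
  by rewrite (big_conj_invariant _ _ (fun y => phi (snoc g' y)) us sx).
rewrite -sumrB; apply: eq_bigr => h _.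
rewrite -[X in _ = X - _]/(l h (phi (snoc g' x)) - (phi (snoc g' (h * x)%g)
  - r x (phi (snoc g' h)))) snoc_eta.
by rewrite opprB addrKA.
Qed.

End TwoSided.

(** * The averaging operator *)

Lemma sum_norm_le {R : realType} {V : normedModType R} {I : Type} (s : seq I)
    (f : I -> V) (c : R) :
  (forall i, `|f i| <= c) -> `|\sum_(i <- s) f i| <= (size s)%:R * c.
Proof.
move=> fc; elim: s => [|i s IH]; first by rewrite big_nil normr0 mul0r.
rewrite big_cons /= -natr1 mulrDl mul1r addrC.
by rewrite (le_trans (ler_normD _ _)) // lerD.
Qed.

(** [1 - T] is bijective when the additive map [T] has norm less than [1]: a
solution [x] of [x - T x = y] is a fixed point of the contraction
[fun x => y + T x]. *)
Lemma contraction_subr_bij {R : realType} {X : completeNormedModType R}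
    (T : X -> X) (q : R) :
  {morph T : x y / x - y} ->
  0 <= q -> q < 1 -> (forall x, `|T x| <= q * `|x|) ->
  forall y, exists! x, x - T x = y.
Proof.
move=> TB q0 q1 Tq y.
pose f : {fun [set: X] >-> [set: X]} := totalfun (fun x => y + T x).
have fB a b : f a - f b = T (a - b).
  by rewrite -[f a]/(y + T a) -[f b]/(y + T b) opprD addrACA subrr add0r TB.
have fc : is_contraction f.
  exists (NngNum q0); split=> //= -[a b] _ /=.
  by rewrite fB.
have [x _ fx] := banach_fixed_point fc closedT (ex_intro _ 0 I).
have fixE a : a - T a = y <-> a = f a.
  rewrite -[f a]/(y + T a); split=> [<-|{1}->]; first by rewrite subrK.
  by rewrite addrK.
exists x; split=> [|x' /fixE fx']; first exact/fixE.
exact: (contraction_fixpoint_unique fc).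
Qed.

(** A finite set of elements with finite [F]-conjugacy orbits lies in a finite
set that is stable under conjugation by [F]. *)
Lemma finite_FC_conj_closed {G : groupType} (F : groupClosed G)
    (E : set (subgroup_of (FC F))) : finite_set E ->
  exists s : seq G, [/\ uniq s, 1%g \in s,
    forall h, E h -> sgval h \in s &
    forall x h, x \in F -> (x * h * x^-1 \in s)%g = (h \in s)].
Proof.
move=> finE.
pose C (h : subgroup_of (FC F)) : set G :=
  [set (f * sgval h * f^-1)%g | f in [set` F]]%classic.
pose K : set G := ([set 1%g] `|` \bigcup_(h in E) C h)%classic.
have : finite_set K.
  rewrite finite_setU; split; first exact: finite_set1.
  by apply: bigcup_finite => // h _; exact/asboolP/(sgvalP h).
move=> /finite_seqP [s Ks]; exists (undup s).
have memK h : h \in undup s <-> K h by rewrite mem_undup Ks.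
have KJ x h : x \in F -> K h -> K (x * h * x^-1)%g.
  move=> Fx [->|[k Ek [f Ff <-]]]; first by left; rewrite mulg1 mulgV.
  right; exists k => //; exists (x * f)%g; first exact: gpredM.
  by rewrite invgM !mulgA.
split; first exact: undup_uniq.
- by apply/memK; left.
- move=> h Eh; apply/memK; right; exists h => //.
  by exists 1%g; rewrite ?mul1g ?invg1 ?mulg1 //; exact: gpred1.
move=> x h Fx; apply/idP/idP => /memK Kh; apply/memK; last exact: KJ.
have := KJ x^-1%g _ _ Kh; rewrite gpredV invgK !mulgA mulVg mul1g mulgVK.
by apply.
Qed.

Section Deviation.
Context {R : realType} {G : groupType} {X : completeNormedModType R}.
Context (rho : banach_module G X) (s : seq G).

(** [deviation] is [#s] times [T - 1], for [T] the mean of the operators [rho h]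
with [h] in [s]. *)
Definition deviation (x : X) : X := \sum_(h <- s) (rho h x - x).

Lemma deviation_linear : linear deviation.
Proof.
move=> a x y; rewrite /deviation scaler_sumr -big_split /=.
by apply: eq_bigr => h _; rewrite linearP opprD scalerBr addrACA.
Qed.

HB.instance Definition _ :=
  GRing.isLinear.Build R X X *:%R deviation deviation_linear.

Lemma deviationC (x : G) (v : X) : uniq s ->
  (forall h, (x * h * x^-1 \in s)%g = (h \in s)) ->
  deviation (rho x v) = rho x (deviation v).
Proof.
move=> us sx; rewrite /deviation linear_sum !sumrB /=.
under [in LHS]eq_bigr do rewrite -module_actM.
rewrite -(big_conj_invariant s x (fun g => rho g v)) // -sumrB.
by apply: eq_bigr => h _; rewrite linearB /= module_actM.
Qed.

(** By uniform convexity, the mean of the operators [rho h] has norm less than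
[1] as soon as [1] is in [s] and unit vectors are uniformly moved by [s]. *)
Lemma norm_average_lt1 (eps : R) :
  uniformly_convex X -> isometric rho -> uniq s -> 1%g \in s -> 0 < eps ->
  (forall x : X, `|x| = 1 -> exists2 h, h \in s & eps <= `|x - rho h x|) ->
  exists q : R, [/\ 0 <= q, q < 1 &
  forall x, `|(size s)%:R^-1 *: \sum_(h <- s) rho h x| <= q * `|x|].
Proof.
move=> ucX rhoI us s1 eps0 moved.
have [delta delta0 ucd] := ucX eps eps0.
have N0 : 0 < (size s)%:R :> R by rewrite ltr0n; case: (s) s1.
(* Nothing bounds [delta] from above, so [q] is truncated to be nonnegative. *)
pose q := Num.max 0 (1 - 2 * delta / (size s)%:R).
have unit_le x : `|x| = 1 ->
    `|\sum_(h <- s) rho h x| <= (size s)%:R - 2 * delta.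
  move=> x1; have [h hs hx] := moved x x1.
  (* The summands of indices [1] and [h] contribute at most [2 - 2 * delta] and
     each of the others contributes [1]. *)
  have h1 : h != 1%g.
    by apply: contraTneq hx => ->; rewrite module_act1 subrr normr0 -ltNge.
  have hs' : h \in rem 1%g s by rewrite mem_rem_uniq // inE h1.
  rewrite (perm_big _ (perm_to_rem s1)) big_cons.
  rewrite (perm_big _ (perm_to_rem hs')) big_cons /= addrA module_act1.
  have -> : (size s)%:R = (size (rem h (rem 1%g s)))%:R + 2 :> R.
    by rewrite (perm_size (perm_to_rem s1)) /= (perm_size (perm_to_rem hs')) /=
      -natrD addn2.
  set S := \sum_(_ <- _) _.
  have := ucd _ _ x1 _ hx; rewrite rhoI => /(_ x1).
  rewrite normrZ ger0_norm ?invr_ge0 ?ler0n // => xhx.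
  have Sle : `|S| <= (size (rem h (rem 1%g s)))%:R.
    by rewrite -[leRHS]mulr1; apply: sum_norm_le => k; rewrite rhoI x1.
  have := ler_normD (x + rho h x) S; lra.
exists q; split.
- by rewrite le_max lexx.
- by rewrite gt_max ltr01 /= ltrBlDr ltrDl divr_gt0 // mulr_gt0.
move=> x; have [->|x0] := eqVneq x 0.
  by rewrite big1 ?scaler0 ?normr0 ?mulr0 // => h _; rewrite linear0.
have nx0 : 0 < `|x| by rewrite normr_gt0.
rewrite -ler_pdivrMr //.
have -> : `|(size s)%:R^-1 *: \sum_(h <- s) rho h x| / `|x| =
    (size s)%:R^-1 * `|\sum_(h <- s) rho h (`|x|^-1 *: x)|.
  under [in RHS]eq_bigr do rewrite linearZ.
  rewrite -scaler_sumr !normrZ !ger0_norm ?invr_ge0 ?ler0n //.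
  by rewrite -mulrA (mulrC `|x|^-1).
rewrite ler_pdivrMl // (le_trans (unit_le _ _)) //.
  by rewrite normrZ normfV normr_id mulVf // gt_eqF.
apply: (@le_trans _ _ ((size s)%:R * (1 - 2 * delta / (size s)%:R))).
  by rewrite mulrBr mulr1 mulrCA divff ?gt_eqF // mulr1.
by rewrite ler_pM2l // le_max lexx orbT.
Qed.

Lemma deviation_bij (eps : R) :
  uniformly_convex X -> isometric rho -> uniq s -> 1%g \in s -> 0 < eps ->
  (forall x : X, `|x| = 1 -> exists2 h, h \in s & eps <= `|x - rho h x|) ->
  forall y, exists! x, deviation x = y.
Proof.
move=> ucX rhoI us s1 eps0 moved y.
have [q [q0 q1 Tq]] := norm_average_lt1 eps ucX rhoI us s1 eps0 moved.
pose T x := (size s)%:R^-1 *: \sum_(h <- s) rho h x.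
have TB : {morph T : x y / x - y}.
  move=> a b; rewrite /T -scalerBr -sumrB; congr (_ *: _).
  by apply: eq_bigr => h _; rewrite linearB.
have N0 : (size s)%:R != 0 :> R by rewrite pnatr_eq0; case: (s) s1.
have devE x : deviation x = - (size s)%:R *: (x - T x).
  rewrite /deviation sumrB /T scalerBr scalerA mulNr divff // scaleN1r opprK.
  rewrite addrC scaleNr; congr (- _ + _).
  by rewrite big_const_seq count_predT iter_addr_0 scaler_nat.
have [x [Tx xuniq]] :=
  contraction_subr_bij T q TB q0 q1 Tq (- (size s)%:R^-1 *: y).
exists x; split=> [|x' dx']; first
  by rewrite devE Tx scalerA mulrNN divff ?scale1r.
by apply: xuniq; rewrite -dx' devE scalerA mulrNN mulVf ?scale1r.
Qed.

End Deviation.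

(** * Vanishing of the restriction *)

Lemma coboundaryE {R : realType} {G : groupType} {X : completeNormedModType R}
    (rho : banach_module G X) n (phi : cochain G X n) :
  coboundary rho phi =
  bicoboundary (fun g => rho g : {linear X -> X}) (fun=> idfun) phi.
Proof. by []. Qed.

Lemma coboundary_equivariant {R : realType} {G : groupType}
    {X : completeNormedModType R} (rho : banach_module G X)
    (A : {linear X -> X}) n (psi : cochain G X n) (g : 'I_n.+1 -> G) :
  (forall v, A (rho (g ord0) v) = rho (g ord0) (A v)) ->
  A (coboundary rho psi g) = coboundary rho (A \o psi : cochain G X n) g.
Proof.
move=> Arho; rewrite /coboundary linearB linearD linearN linearZ Arho linear_sum.
by congr (_ - _); apply: eq_bigr => i _; rewrite linearZ.
Qed.

Theorem theorem1p4 (R : realType) (G : groupType)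
    (X : completeNormedModType R) (rho : banach_module G X)
    (F : groupClosed G) :
  uniformly_convex X ->
  isometric rho ->
  ~ almost_invariant_unit_vectors (restrict_module rho (FC F)) ->
  forall (n : nat) (c : cohomology rho n), res_cohomology F c = 0.
Proof.
move=> ucX rhoI nainv n c.
have [E [eps [finE eps0 Emoved]]] :
    exists (E : set (subgroup_of (FC F))) (eps : R),
    [/\ finite_set E, 0 < eps & forall x : X, `|x| = 1 ->
      exists2 h, E h & eps <= `|x - rho (sgval h) x|].
  apply: contra_notP nainv => nE E eps finE eps0.
  apply: contra_notP nE => nx; exists E, eps; split=> // x x1.
  apply: contra_notP nx => nh; exists x => // h Eh.
  by rewrite ltNge; apply/negP => hx; apply: nh; exists h.
have [s [us s1 Es sF]] := finite_FC_conj_closed F E finE.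
have smoved (x : X) : `|x| = 1 -> exists2 h, h \in s & eps <= `|x - rho h x|.
  by move=> /Emoved [h /Es hs hx]; exists (sgval h).
have Abij := deviation_bij rho s eps ucX rhoI us s1 eps0 smoved.
have Ainj : injective (deviation rho s).
  move=> x y Axy; have [v [_ vu]] := Abij (deviation rho s x).
  by rewrite -(vu x) // (vu y).
have Asurj y : exists x, deviation rho s x = y.
  by have [x [Ax _]] := Abij y; exists x.
rewrite -(cohomology_class_repr c); move: (repr _) => {c} z.
rewrite res_cohomology_class -(raddf0 (@cohomology_class _ _ _ _ n)).
apply/cohomology_classP; rewrite subr0 /=.
move: (cocycle_val z) (cocycleP z) => {z} phi /eqP; rewrite coboundaryE => phi0.
have [b bR bP] := bicocycle_sub_range (mem F) s us sF _ _ _ _ _ phi0.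
have {}bP (f : 'I_n -> subgroup_of F) :
    deviation rho s (phi (fun i => sgval (f i))) = b (fun i => sgval (f i)).
  by rewrite -bP // => i; exact: sgvalP.
(* Injectivity of the deviation suffices in degree 0; in positive degree a
   primitive is pulled back along it. *)
case: n => [|n] in phi phi0 b bR bP *.
  apply/funext => f; apply: Ainj; rewrite [LHS]bP bR.
  by rewrite linear0.
have [psi bE] := bR.
have /choice [A' A'K] := Asurj.
pose psi' : cochain G X n := fun g => A' (psi g).
exists (res_cochain psi') => //; rewrite coboundary_res.
apply/funext => f; apply: Ainj; rewrite [RHS]bP bE -coboundaryE /res_cochain.
rewrite coboundary_equivariant => [|v]; last first.
  by apply: deviationC => // h; apply: sF; exact: sgvalP.
by congr (coboundary rho _ _); apply/funext => g; exact: A'K.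
Qed.
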